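(* Let $A$ be a Banach algebra, and let $a,b\in A$ have generalized Hirano inverses. If $a^2b=aba$ and $b^2a=bab$, then $a+b$ has generalized Hirano inverse if and only if $1+a^db$ has generalized Hirano inverse.
   Context: All Banach algebras are complex with identity $1$. For $a\in A$, $comm(a)=\{x\in A : xa=ax\}$, and $A^{qnil}=\{a\in A : 1+ax \text{ is invertible in } A \text{ for all } x\in comm(a)\}$ is the set of quasinilpotent elements. An element $a\in A$ has generalized Hirano inverse if there exists $b\in comm(a)$ with $b=bab$ and $a^2-ab\in A^{qnil}$. An element $a\in A$ has g-Drazin inverse if there exists $b\in comm(a)$ with $b=bab$ and $a-a^2b\in A^{qnil}$; such $b$ is unique if it exists and is denoted $a^d$. Every element having generalized Hirano inverse has g-Drazin inverse, so $a^d$ is defined here. *)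

(* Defs.v *)
From HB Require Import structures.
From mathcomp Require Import all_boot all_order all_algebra.
From mathcomp Require Import all_classical all_reals.
From mathcomp Require Export complex.

Set Implicit Arguments.
Unset Strict Implicit.
Unset Printing Implicit Defensive.
Import Order.TTheory GRing.Theory Num.Theory.

Local Open Scope ring_scope.
Local Open Scope classical_set_scope.

(* The norm is a separate field because Hierarchy-Builder cannot join the
   normed modules of MathComp-Analysis with the ring structures: [numDomainType]
   already inherits from both [semiNormedZmodType] and [unitRingType], so a new
   common descendant would need an intermediate join declared below it.
   [Re `|z|] is the modulus of [z] as an element of [R].
   The [UnitAlgebra] component only adds the predicate [GRing.unit], which is by
   its axioms two-sided invertibility. *)
HB.mixin Record UnitAlgebra_isBanach (R : realType) A
    of GRing.UnitAlgebra R[i] A := {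
  bnorm : A -> R;
  bnorm0_eq0 : forall x, bnorm x = 0 -> x = 0;
  bnormD_le : forall x y, bnorm (x + y) <= bnorm x + bnorm y;
  bnormZ : forall (z : R[i]) x, bnorm (z *: x) = complex.Re `|z| * bnorm x;
  bnormM_le : forall x y, bnorm (x * y) <= bnorm x * bnorm y;
  bnorm_complete : forall u : nat -> A,
    (forall e : R, 0 < e -> exists N : nat, forall m n : nat,
       (N <= m)%N -> (N <= n)%N -> bnorm (u m - u n) < e) ->
    exists l : A, forall e : R, 0 < e -> exists N : nat, forall n : nat,
       (N <= n)%N -> bnorm (u n - l) < e
}.

#[short(type="banachAlgType")]
HB.structure Definition BanachAlgebra (R : realType) :=
  {A of GRing.UnitAlgebra R[i] A & UnitAlgebra_isBanach R A}.

Section GeneralizedInverses.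
Variables (R : realType) (A : banachAlgType R).
Implicit Types a b x : A.

Definition comm a : set A := [set x | x * a = a * x].

Definition qnil : set A :=
  [set a | forall x, comm a x -> 1 + a * x \is a GRing.unit].

Definition has_gHirano_inverse a : Prop :=
  exists b, [/\ comm a b, b = b * a * b & qnil (a ^+ 2 - a * b)].

Definition is_gDrazin_inverse a b : Prop :=
  [/\ comm a b, b = b * a * b & qnil (a - a ^+ 2 * b)].

(* The g-Drazin inverse a^d; the value is 0 if there is none. *)
Definition gDrazin a : A := xget 0 (is_gDrazin_inverse a).

End GeneralizedInverses.

(* Main.v *)
Require Import Defs.
From mathcomp Require Import all_boot all_order all_algebra.
From mathcomp Require Import all_classical all_reals.
From mathcomp Require Import topology normedtype lra ring.
From Stdlib Require Ncring Ncring_tac.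

(** In the inverse-closed subalgebra [B] generated by [a], [b] and [d := gDrazin a],
    the commutator [c := a b - b a] satisfies [a c = b c = d c = 0], so every
    element of [B] acts on [c] by a scalar and all commutators lie in [c A].  It
    follows that [B] is commutative modulo its Jacobson radical and that the
    radical consists of the quasinilpotent elements of [B].  An element [x] has a
    generalized Hirano inverse iff [x - x^3] is quasinilpotent, so the question
    becomes one about commuting [a], [b] with [a^3 = a], [b^3 = b], [d = a]: there
    [s - s^3 = - 3 (a^2 b + a b^2)] for [s = a + b], [t - t^3 = - 3 (a^2 b^2 + a b)]
    for [t = 1 + d b], and multiplication by [a] exchanges the two brackets.

    Analysis enters twice: if [1 - l a] is invertible for all scalars [l], then
    [a] has spectral radius [0]; and [x] is a quasinilpotent perturbation of
    an idempotent as soon as [x - x^2] is quasinilpotent. *)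

Set Implicit Arguments.
Unset Strict Implicit.
Unset Printing Implicit Defensive.
Import Order.TTheory GRing.Theory Num.Theory.
Local Open Scope ring_scope.

(** * Normalisation of identities in non-commutative rings *)

Definition ncring_ops (T : pzRingType) :
  @Ncring.Ring_ops T 0 1 +%R *%R (fun x y => x - y) -%R eq :=
  Ncring.Build_Ring_ops _ _ _ _ _ _ _.

Lemma ncring_ring (T : pzRingType) : Ncring.Ring (Ro := ncring_ops T).
Proof.
split; cbv [Algebra_syntax.equality Algebra_syntax.addition
  Algebra_syntax.multiplication Algebra_syntax.opposite
  Algebra_syntax.subtraction Algebra_syntax.zero Algebra_syntax.one
  Ncring.eq_notation Ncring.add_notation Ncring.zero_notation
  Ncring.one_notation Ncring.mul_notation Ncring.opp_notation
  Ncring.sub_notation].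
- exact: RelationClasses.eq_equivalence.
- by move=> ? ? -> ? ? ->.
- by move=> ? ? -> ? ? ->.
- by move=> ? ? -> ? ? ->.
- by move=> ? ? ->.
- exact: add0r.
- exact: addrC.
- exact: addrA.
- exact: mul1r.
- exact: mulr1.
- exact: mulrA.
- exact: mulrDl.
- by move=> x y z; exact: mulrDr.
- by [].
- exact: subrr.
Qed.

#[local] Existing Instance ncring_ops.
#[local] Existing Instance ncring_ring.

Ltac ncring := do ?rewrite exprS; do ?rewrite expr0; Ncring_tac.non_commutative_ring.

(** * Modulus of scalars and elementary norm estimates *)

Section Norm.
Variables (R : realType) (A : banachAlgType R).
Implicit Types (x y z : A) (l : R[i]).

Definition modulus l : R := complex.Re `|l|.

Lemma modulusE l : `|l| = (modulus l)%:C%C.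
Proof. by rewrite /modulus normc_def. Qed.

Lemma modulus_ge0 l : 0 <= modulus l.
Proof. by have := normr_ge0 l; rewrite modulusE ler0c. Qed.

Lemma modulus0 : modulus 0 = 0.
Proof. by rewrite /modulus normr0. Qed.

Lemma modulus1 : modulus 1 = 1.
Proof. by rewrite /modulus normr1. Qed.

Lemma modulusN l : modulus (- l) = modulus l.
Proof. by rewrite /modulus normrN. Qed.

Lemma modulusM l m : modulus (l * m) = modulus l * modulus m.
Proof. by apply: complexI; rewrite rmorphM /= -!modulusE normrM. Qed.

Lemma modulusX l n : modulus (l ^+ n) = modulus l ^+ n.
Proof. by elim: n => [|n IH]; rewrite ?modulus1 // !exprS modulusM IH. Qed.

Lemma modulus_real (s : R) : modulus s%:C%C = `|s|.
Proof. by rewrite /modulus normc_def /= expr0n addr0 sqrtr_sqr. Qed.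

Lemma modulus_le_ReIm l : modulus l <= `|complex.Re l| + `|complex.Im l|.
Proof.
rewrite /modulus normc_def /=.
rewrite -[leRHS]ger0_norm ?addr_ge0 // -sqrtr_sqr ler_wsqrtr // sqrrD.
rewrite !real_normK ?num_real //.
have := mulr_ge0 (normr_ge0 (complex.Re l)) (normr_ge0 (complex.Im l)); lra.
Qed.

Lemma Re_le_modulus l : `|complex.Re l| <= modulus l.
Proof. by have := normc_ge_Re l; rewrite modulusE lecR. Qed.

Lemma Im_le_modulus l : `|complex.Im l| <= modulus l.
Proof.
rewrite /modulus normc_def /= -sqrtr_sqr ler_wsqrtr //.
have := sqr_ge0 (complex.Re l); lra.
Qed.

Lemma bnorm0 : bnorm (0 : A) = 0.
Proof. by rewrite -(scale0r (0 : A)) bnormZ -/(modulus 0) modulus0 mul0r. Qed.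

Lemma bnormN x : bnorm (- x) = bnorm x.
Proof. by rewrite -scaleN1r bnormZ -/(modulus _) modulusN modulus1 mul1r. Qed.

Lemma bnorm_ge0 x : 0 <= bnorm x.
Proof. have := bnormD_le x (- x); rewrite subrr bnorm0 bnormN; lra. Qed.

Lemma bnormB_le x y : bnorm (x - y) <= bnorm x + bnorm y.
Proof. by rewrite -(bnormN y) bnormD_le. Qed.

Lemma bnormMn x n : bnorm (x *+ n) <= n%:R * bnorm x.
Proof.
elim: n => [|n IH]; first by rewrite mulr0n bnorm0 mul0r.
rewrite mulrSr -natr1 mulrDl mul1r.
by apply: (le_trans (bnormD_le _ _)); rewrite lerD2r.
Qed.

Lemma bnormX_le x n : bnorm (x ^+ n.+1) <= bnorm x ^+ n.+1.
Proof.
elim: n => [|n IH]; first by rewrite !expr1.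
rewrite exprS [leRHS]exprS; apply: (le_trans (bnormM_le _ _)).
by apply: ler_wpM2l => //; apply: bnorm_ge0.
Qed.

Lemma bnorm1_ge1 : 1 <= bnorm (1 : A).
Proof.
have h : bnorm (1 : A) <= bnorm (1 : A) * bnorm (1 : A).
  by rewrite -{1}(mulr1 (1 : A)) bnormM_le.
have h0 : bnorm (1 : A) != 0.
  by apply/eqP => /bnorm0_eq0/eqP; rewrite oner_eq0.
have hp : 0 < bnorm (1 : A) by rewrite lt_neqAle eq_sym h0 bnorm_ge0.
by move: h; rewrite -{1}(mulr1 (bnorm 1)) ler_pM2l.
Qed.

(** * Geometrically convergent sequences *)

(** With the ratio fixed at 1/2, sums and products only change the constant [C]. *)
Definition gcvg (u : nat -> A) (l : A) :=
  exists C : R, forall k, bnorm (u k - l) <= C * 2^-1 ^+ k.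

Lemma half_exp_small (C e : R) : 0 < e ->
  exists N, forall n, (N <= n)%N -> C * 2^-1 ^+ n < e.
Proof.
move=> e0; have [C0|C0] := leP C 0.
  exists 0 => n _; apply: le_lt_trans e0.
  by rewrite mulr_le0_ge0 // exprn_ge0 // invr_ge0 ler0n.
have [N hN] : exists N : nat, C / e < N%:R.
  by exists (Num.truncn (C / e)).+1; apply: truncnS_gt.
exists N => n Nn.
rewrite exprVn ltr_pdivrMr ?exprn_gt0 ?ltr0n // mulrC -ltr_pdivrMr //.
apply: (lt_trans hN); rewrite -natrX ltr_nat.
by apply: leq_ltn_trans Nn _; apply: ltn_expl.
Qed.

Lemma gcvg_cst (x : A) : gcvg (fun=> x) x.
Proof. by exists 0 => k; rewrite subrr bnorm0 mul0r. Qed.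

Lemma half_pow_ge0 k : 0 <= (2^-1 : R) ^+ k.
Proof. by rewrite exprn_ge0 // invr_ge0 ler0n. Qed.

Lemma gcvgD u v (l m : A) : gcvg u l -> gcvg v m -> gcvg (fun k => u k + v k) (l + m).
Proof.
move=> [C hC] [D hD]; exists (C + D) => k.
rewrite opprD addrACA mulrDl; apply: (le_trans (bnormD_le _ _)).
by rewrite lerD.
Qed.

Lemma gcvgN u (l : A) : gcvg u l -> gcvg (fun k => - u k) (- l).
Proof. by move=> [C hC]; exists C => k; rewrite -opprD bnormN. Qed.

Lemma gcvgM u v (l m : A) : gcvg u l -> gcvg v m -> gcvg (fun k => u k * v k) (l * m).
Proof.
move=> [C hC] [D hD].
have C0 : 0 <= C by have := le_trans (bnorm_ge0 _) (hC 0); rewrite expr0 mulr1.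
have D0 : 0 <= D by have := le_trans (bnorm_ge0 _) (hD 0); rewrite expr0 mulr1.
exists (C * D + C * bnorm m + bnorm l * D) => k.
have -> : u k * v k - l * m =
  (u k - l) * (v k - m) + (u k - l) * m + l * (v k - m) by ncring.
rewrite [leRHS]mulrDl [in leRHS]mulrDl; apply: (le_trans (bnormD_le _ _)).
apply: lerD; last first.
  rewrite -mulrA; apply: (le_trans (bnormM_le _ _)).
  by apply: ler_wpM2l => //; apply: bnorm_ge0.
apply: (le_trans (bnormD_le _ _)); apply: lerD; last first.
  rewrite mulrAC; apply: (le_trans (bnormM_le _ _)).
  by apply: ler_wpM2r => //; apply: bnorm_ge0.
apply: (le_trans (bnormM_le _ _)).
apply: (@le_trans _ _ ((C * 2^-1 ^+ k) * D)).
  apply: ler_pM; rewrite ?bnorm_ge0 //; apply: (le_trans (hD k)).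
  rewrite -[leRHS]mulr1; apply: ler_wpM2l => //.
  by apply: exprn_ile1; rewrite ?invr_ge0 ?ler0n // invf_le1 ?ltr0n // ler1n.
by rewrite mulrAC.
Qed.

Lemma gcvg_unique u (l m : A) : gcvg u l -> gcvg u m -> l = m.
Proof.
move=> [C hC] [D hD]; apply/eqP; rewrite -subr_eq0; apply/eqP.
apply: bnorm0_eq0; apply/eqP; rewrite eq_le bnorm_ge0 andbT.
apply/ler_addgt0Pr => e e0; rewrite add0r.
have [N hN] := half_exp_small (C + D) e0.
apply: le_trans (ltW (hN N (leqnn N))).
have -> : l - m = (u N - m) - (u N - l) by ncring.
apply: (le_trans (bnormB_le _ _)); have := hC N; have := hD N; lra.
Qed.

Lemma gcvg_ext u v (l : A) : (forall k, u k = v k) -> gcvg u l -> gcvg v l.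
Proof. by move=> uv [C hC]; exists C => k; rewrite -uv. Qed.

Lemma gcvg_of_increments u (C : R) :
  (forall k, bnorm (u k.+1 - u k) <= C * 2^-1 ^+ k) -> exists l : A, gcvg u l.
Proof.
move=> hC.
have C0 : 0 <= C by have := le_trans (bnorm_ge0 _) (hC 0); rewrite expr0 mulr1.
(* The subtracted term lets the induction on [k] close; dropping it leaves a tail bound independent
   of [k]. *)
have tail n k :
    bnorm (u (n + k)%N - u n) <= C * 2 * 2^-1 ^+ n - C * 2 * 2^-1 ^+ (n + k).
  elim: k => [|k IH]; first by rewrite addn0 !subrr bnorm0.
  have -> : u (n + k.+1)%N - u n =
    (u (n + k).+1 - u (n + k)%N) + (u (n + k)%N - u n) by rewrite addnS; ncring.
  apply: (le_trans (bnormD_le _ _)).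
  have := hC (n + k)%N; rewrite addnS (exprS _ (n + k)).
  move: IH; set p := _ ^+ (n + k); lra.
have tail' n m : (n <= m)%N -> bnorm (u m - u n) <= C * 2 * 2^-1 ^+ n.
  move=> nm; rewrite -(subnKC nm); apply: (le_trans (tail _ _)).
  by rewrite gerBl mulr_ge0 ?half_pow_ge0 // mulr_ge0 // ler0n.
have [|l hl] := @bnorm_complete _ _ u.
  move=> e e0; have [N hN] := half_exp_small (C * 2) (e := e / 2) ltac:(lra).
  exists N => m n Nm Nn.
  have -> : u m - u n = (u m - u N) - (u n - u N) by ncring.
  apply: (le_lt_trans (bnormB_le _ _)).
  have := tail' _ _ Nm; have := tail' _ _ Nn; have := hN N (leqnn N); lra.
exists l; exists (C * 2) => k.
apply/ler_addgt0Pr => e e0.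
have [N hN] := hl _ e0.
have := hN (maxn k N) (leq_maxr _ _).
have := tail' _ _ (leq_maxl k N).
have -> : u k - l = (u (maxn k N) - l) - (u (maxn k N) - u k) by ncring.
have := bnormB_le (u (maxn k N) - l) (u (maxn k N) - u k); lra.
Qed.

Lemma comm_gcvg u (l : A) x :
  (forall k, u k * x = x * u k) -> gcvg u l -> l * x = x * l.
Proof.
move=> ux ul; apply: (@gcvg_unique (fun k => u k * x)).
  by apply: gcvgM => //; apply: gcvg_cst.
by apply: (gcvg_ext (fun k => esym (ux k))); apply: gcvgM => //; apply: gcvg_cst.
Qed.

(** * Neumann series *)

Lemma unitrP2 (x y : A) : x * y = 1 -> y * x = 1 -> x \is a GRing.unit.
Proof. by move=> xy yx; apply/unitrP; exists y. Qed.

Lemma unit_sub1_half y : bnorm y <= 2^-1 -> 1 - y \is a GRing.unit.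
Proof.
move=> hy; pose S n := \sum_(i < n) y ^+ i.
have yk k : bnorm (y ^+ k) <= bnorm (1 : A) * 2^-1 ^+ k.
  elim: k => [|k IH]; first by rewrite !expr0 mulr1.
  rewrite exprS [_ ^+ k.+1]exprS mulrCA; apply: (le_trans (bnormM_le _ _)).
  by apply: ler_pM; rewrite ?bnorm_ge0.
have [|l Sl] := @gcvg_of_increments S (bnorm (1 : A)).
  by move=> k; rewrite /S big_ord_recr /= addrAC subrr add0r.
have E k : (1 - y) * S k = 1 - y ^+ k by rewrite -[LHS]opprK -mulNr opprB -subrX1 opprB.
have E' k : S k * (1 - y) = 1 - y ^+ k.
  rewrite -E; apply/esym/commr_sum => i _; apply/commrX/commr_sym.
  by apply: commrB; [apply: commr1|].
have y0 : gcvg (fun k => 1 - y ^+ k) 1.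
  exists (bnorm (1 : A)) => k; by rewrite addrAC subrr add0r bnormN.
apply: (@unitrP2 _ l).
  apply: gcvg_unique y0; apply: (gcvg_ext E); apply: gcvgM => //.
  exact: gcvg_cst.
apply: gcvg_unique y0; apply: (gcvg_ext E'); apply: gcvgM => //.
exact: gcvg_cst.
Qed.

(** The inverse [g] of [1 - y] satisfies [g = 1 + y * g], whence |g| <= |1| + |g|/2. *)
Lemma bnorm_inv_half y : bnorm y <= 2^-1 -> bnorm ((1 - y)^-1) <= 2 * bnorm (1 : A).
Proof.
move=> hy; have U := unit_sub1_half hy.
have E : (1 - y)^-1 = 1 + y * (1 - y)^-1.
  by rewrite -[LHS]mul1r -{1}(subrK y 1) mulrDl mulrV.
have := bnormD_le 1 (y * (1 - y)^-1); rewrite -E.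
have := bnormM_le y (1 - y)^-1.
have := ler_wpM2r (bnorm_ge0 (1 - y)^-1) hy.
set z := bnorm _^-1; lra.
Qed.

End Norm.

(** * The spectral radius *)

Section SpectralRadius.
Variables (R : realType) (A : banachAlgType R).
Implicit Types (x y z : A) (l m : R[i]).

(** For nonzero [l] this says that [l^-1] is not a spectral value: the spectrum of [x] lies in
    {0}. *)
Definition spec0 x := forall l, 1 - l *: x \is a GRing.unit.

Lemma pow_unbounded (h C : R) : 0 < h -> exists n : nat, C < (1 + h) ^+ n.
Proof.
move=> h0; exists (Num.truncn (C / h)).+1.
have bern n : 1 + h *+ n <= (1 + h) ^+ n.
  elim: n => [|n IH]; first by rewrite mulr0n addr0 expr0.
  have p : 0 <= h *+ n by rewrite mulrn_wge0 // ltW.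
  rewrite exprS mulrS; apply: (@le_trans _ _ ((1 + h) * (1 + h *+ n))); nra.
apply: lt_le_trans (bern _).
have : C < h *+ (Num.truncn (C / h)).+1.
  by rewrite -mulr_natr mulrC -ltr_pdivrMr //; apply: truncnS_gt.
by lra.
Qed.

(** * Resolvent bounds and decay of powers *)

Section Resolvent.
Variables (a : A) (a0 : spec0 a).

(** Factor [1 - l a = (1 - (l - l0) a g) (1 - l0 a)]; the radius keeps the first factor within 1/2
    of [1]. *)
Lemma resolvent_bound_near l0 : exists2 M : R, 0 <= M & exists2 d : R, 0 < d &
  forall l, modulus (l - l0) <= d -> bnorm ((1 - l *: a)^-1) <= M.
Proof.
set g := (1 - l0 *: a)^-1.
exists (bnorm g * (2 * bnorm (1 : A))); first by rewrite !mulr_ge0 ?bnorm_ge0.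
have p : 0 < 2 * (1 + bnorm (a * g)) by have := bnorm_ge0 (a * g); lra.
exists (2 * (1 + bnorm (a * g)))^-1 => [|l hl]; first by rewrite invr_gt0.
have E : 1 - l *: a = (1 - (l - l0) *: (a * g)) * (1 - l0 *: a).
  rewrite mulrBl mul1r -scalerAl -mulrA mulVr ?a0 // mulr1 scalerBl.
  by rewrite opprB addrA subrK.
have hw : bnorm ((l - l0) *: (a * g)) <= 2^-1.
  rewrite bnormZ -/(modulus _); have := bnorm_ge0 (a * g) => n0.
  apply: (@le_trans _ _ ((2 * (1 + bnorm (a * g)))^-1 * bnorm (a * g))).
    by apply: ler_wpM2r.
  rewrite ler_pdivrMl //; lra.
rewrite E invrM ?a0 ?unit_sub1_half //.
apply: (le_trans (bnormM_le _ _)); apply: ler_wpM2l; first exact: bnorm_ge0.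
exact: bnorm_inv_half.
Qed.

Import numFieldNormedType.Exports.

(** Compactness of a square containing the disc makes the local bounds uniform: near each point
    every large enough [N] is a bound. *)
Lemma resolvent_bound_disc (r : R) : exists2 M : R, 0 <= M &
  forall l, modulus l <= r -> bnorm ((1 - l *: a)^-1) <= M.
Proof.
pose K := (`[- r, r]%classic `*` `[- r, r]%classic)%classic : set (R * R)%type.
have cK : compact K by apply: compact_setX; apply: segment_compact.
pose P (M : R) (p : R * R) := bnorm ((1 - (p.1 +i* p.2)%C *: a)^-1) <= M.
have := (compact_near_coveringP K).1 cK R (pinfty_nbhs R) P _.
case => [[x y] _|N [_ hN]].
  have [M M0 [d d0 hM]] := resolvent_bound_near (x +i* y)%C.
  exists (ball (x, y) (d / 2), [set N | M < N]%classic).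
    split; first by apply: nbhsx_ballx; lra.
    by exists M; split => //; apply: num_real.
  move=> [[u v] N] [/= [hu hv] MN]; apply: le_trans (ltW MN); apply: hM.
  apply: (le_trans (modulus_le_ReIm _)) => /=.
  move: hu hv; rewrite /ball /= => hu hv.
  by have := distrC x u; have := distrC y v; lra.
exists (`|N| + 1); first by have := normr_ge0 N; lra.
move=> [u v] hl; apply: (hN _ _ (u, v)).
  by have := ler_norm N; lra.
by rewrite /K /= !in_itv /= -!ler_norml; split;
  apply: le_trans hl;
  [exact: (Re_le_modulus (u +i* v)%C)|exact: (Im_le_modulus (u +i* v)%C)].
Qed.

(* [U_k(l) := (1 - l a^(2^k))^-1] satisfies [U_(k+1)(l^2) = (U_k(l) + U_k(-l))/2];
   hence [l |-> U_k(l^(2^k))] is an average of rotated copies of the resolvent and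
   inherits, uniformly in [k], its radial Lipschitz constant on a disc. *)
Definition dyadic_resolvent k l : A := (1 - l *: a ^+ (2 ^ k))^-1.

Lemma unit_dyadic k l : 1 - l *: a ^+ (2 ^ k) \is a GRing.unit.
Proof.
elim: k l => [|k IH] l; first by rewrite expn0 expr1; apply: a0.
(* With a complex square root of [l], the element becomes [1 - x^2 = (1 - x)(1 + x)]. *)
rewrite -(sqrtCK l) expnSr exprM -exprZn.
set x := _ *: _.
have -> : 1 - x ^+ 2 = (1 - x) * (1 - - x) by ncring.
rewrite unitrMl; last by rewrite /x -scaleNr; apply: IH.
exact: IH.
Qed.

Lemma dyadic_resolvent_avg k l : dyadic_resolvent k.+1 (l ^+ 2) =
  2^-1 *: (dyadic_resolvent k l + dyadic_resolvent k (- l)).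
Proof.
rewrite /dyadic_resolvent expnSr exprM -exprZn.
have U := unit_dyadic k l; have := unit_dyadic k (- l).
rewrite scaleNr; move: U; set x := _ *: _ => U V.
have -> : 1 - x ^+ 2 = (1 - - x) * (1 - x) by ncring.
rewrite invrM //.
have -> : (1 - x)^-1 + (1 - - x)^-1 = (1 - x)^-1 * (2%:R *: (1 - - x)^-1).
  have p1 := mulVr U; have q1 := mulrV V; move: p1 q1.
  set p := (1 - x)^-1; set q := (1 - - x)^-1 => p1 q1.
  have -> : p + q = p * ((1 - - x) * q) + p * (1 - x) * q.
    by rewrite p1 q1 mulr1 mul1r.
  rewrite scaler_nat mulr2n; ncring.
by rewrite -scalerAr scalerA mulVf ?scale1r // pnatr_eq0.
Qed.

(** For [k = 0] this is the resolvent identity; averaging two differences that obey the bound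
    preserves it, so [L] is independent of [k]. *)
Lemma dyadic_resolvent_lipschitz (r : R) : exists2 L : R, 0 <= L &
  forall k l (s : R), modulus l <= r -> 0 <= s <= 1 ->
  bnorm (dyadic_resolvent k (l ^+ (2 ^ k)) -
         dyadic_resolvent k ((s%:C%C * l) ^+ (2 ^ k))) <= L * (1 - s).
Proof.
have [M M0 hM] := resolvent_bound_disc r.
have r0 : 0 <= Num.max 0 r by rewrite le_max lexx.
exists (Num.max 0 r * (M * bnorm a * M)).
  by rewrite !mulr_ge0 ?bnorm_ge0.
elim=> [|k IH] l s lr /andP[s0 s1].
  rewrite /dyadic_resolvent expn0 !expr1.
  have -> : (1 - l *: a)^-1 - (1 - (s%:C%C * l) *: a)^-1 =
    (1 - l *: a)^-1 * ((l - s%:C%C * l) *: a) * (1 - (s%:C%C * l) *: a)^-1.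
    have -> : (l - s%:C%C * l) *: a = (1 - (s%:C%C * l) *: a) - (1 - l *: a).
      by rewrite scalerBl; ncring.
    by rewrite mulrBr mulrBl mulVr ?a0 // mul1r -mulrA mulrV ?a0 // mulr1.
  have sl : modulus (s%:C%C * l) <= r.
    rewrite modulusM modulus_real ger0_norm //; apply: le_trans lr.
    by rewrite -[leRHS]mul1r; apply: ler_wpM2r => //; apply: modulus_ge0.
  have dl : modulus (l - s%:C%C * l) = modulus l * (1 - s).
    have -> : l - s%:C%C * l = (1 - s)%:C%C * l by rewrite rmorphB /=; ring.
    by rewrite modulusM modulus_real ger0_norm ?subr_ge0 // mulrC.
  have h1 := hM _ lr; have h2 := hM _ sl.
  apply: (le_trans (bnormM_le _ _)); rewrite mulrAC mulrA.
  apply: ler_pM; rewrite ?bnorm_ge0 //.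
  apply: (le_trans (bnormM_le _ _)); rewrite bnormZ -/(modulus _) dl.
  have -> : Num.max 0 r * (1 - s) * (M * bnorm a) =
    M * (Num.max 0 r * (1 - s) * bnorm a) by ring.
  apply: ler_pM; rewrite ?bnorm_ge0 ?mulr_ge0 ?bnorm_ge0 ?modulus_ge0 ?subr_ge0 //.
  apply: ler_wpM2r; rewrite ?bnorm_ge0 //; apply: ler_wpM2r; rewrite ?subr_ge0 //.
  by rewrite le_max lr orbT.
(* Since [c ^+ (2 ^ k) = -1] and [c] has modulus 1, the second term of the average is the first one
   at the rotated point [c * l]. *)
pose c : R[i] := (2 ^ k).-root (-1).
have k0 : (0 < 2 ^ k)%N by rewrite expn_gt0.
have c1 : c ^+ (2 ^ k) = -1 by rewrite rootCK.
have mc : modulus c = 1.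
  apply/eqP; rewrite -(@pexpr_eq1 _ _ (2 ^ k)) ?modulus_ge0 //.
  by rewrite -modulusX c1 modulusN modulus1.
have cl : modulus (c * l) <= r by rewrite modulusM mc mul1r.
have N1 (x : R[i]) : - x ^+ (2 ^ k) = (c * x) ^+ (2 ^ k) by rewrite exprMn c1 mulN1r.
rewrite expnSr !(exprM _ (2 ^ k)) !dyadic_resolvent_avg !N1 -scalerBr.
rewrite opprD addrACA bnormZ (mulrCA c) -/(modulus _).
have -> : modulus 2^-1 = 2^-1 :> R.
  have -> : 2^-1 = (2^-1 : R)%:C%C :> R[i] by rewrite fmorphV rmorph_nat.
  by rewrite modulus_real ger0_norm // invr_ge0 ler0n.
have s01 : 0 <= s <= 1 by rewrite s0.
have H1 := IH _ _ lr s01; have H2 := IH _ _ cl s01; move: H1 H2.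
set X : A := _ - _; set Y : A := _ - _; have := bnormD_le X Y.
set B := Num.max _ _ * _ * _ => h3 h4 h5.
lra.
Qed.

(** The constant is independent of [r], so enlarging the radius can be iterated; 3 = 1 + 2 comes
    from |t| <= |1| + |1 - t| and [bnorm_inv_half]. *)
Let eventually_bounded (r : R) := exists K, forall k, (K <= k)%N ->
  r ^+ (2 ^ k) * bnorm (a ^+ (2 ^ k)) <= 3 * bnorm (1 : A).

(* If [U_k] is close to [1] at radius [q / (1 + h)^2], it is so at radius [q] by the
   uniform Lipschitz bound, whence [(q a)^(2^k)] is bounded; this bound makes [U_k]
   close to [1] at every smaller radius, and the step is repeated. *)
Lemma dyadic_powers_bounded (r : R) : 0 <= r -> eventually_bounded r.
Proof.
move=> r0; have [L L0 hL] := dyadic_resolvent_lipschitz r.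
(* For s = (1 + h)^-2 one has 1 - s <= 2h, so this choice gives L(1 - s) <= 1/4. *)
pose h := (8 * (L + 1))^-1.
have h0 : 0 < h by rewrite invr_gt0; lra.
have Lh : (8 * (L + 1)) * h = 1 by rewrite mulfV //; apply/eqP; lra.
have b1 := bnorm1_ge1 A.
have step (q : R) : 0 <= q <= r -> eventually_bounded (q / (1 + h)) ->
    eventually_bounded q.
  move=> /andP[q0 qr] [K hK].
  (* Going from radius q/(1 + h) down to q/(1 + h)^2 gains the factor (1 + h)^(2^k); once it exceeds
     24|1|^2, the bound 3|1| becomes |z| <= 1/(8|1|). *)
  have [n hn] := pow_unbounded (24 * bnorm (1 : A) ^+ 2) h0.
  exists (maxn K n) => k; rewrite geq_max => /andP[Kk nk].
  have {}hn : 24 * bnorm (1 : A) ^+ 2 < (1 + h) ^+ (2 ^ k).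
    apply: (lt_le_trans hn); rewrite ler_weXn2l //; first lra.
    by apply: (leq_trans nk); apply/ltnW/ltn_expl.
  pose s := ((1 + h) ^+ 2)^-1.
  have sp : s * (1 + h) ^+ 2 = 1 by rewrite mulVf // expf_neq0 //; apply/eqP; lra.
  have s01 : 0 <= s <= 1.
    rewrite invr_ge0 exprn_ge0 /=; last lra.
    by rewrite invf_le1 ?exprn_gt0 ?exprn_ege1 //; lra.
  have s1h : L * (1 - s) <= 4^-1.
    have [s0 s1] := andP s01; rewrite expr2 in sp; nra.
  have mq : modulus q%:C%C <= r by rewrite modulus_real ger0_norm.
  have := hL k _ _ mq s01; set G := dyadic_resolvent _ _.
  rewrite -rmorphM -!rmorphXn /=.
  set z : A := ((s * q) ^+ (2 ^ k))%:C%C *: a ^+ (2 ^ k).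
  have -> : dyadic_resolvent k ((s * q) ^+ (2 ^ k))%:C%C = (1 - z)^-1 by [].
  have z_small : bnorm z * (8 * bnorm (1 : A)) <= 1.
    rewrite bnormZ -/(modulus _) modulus_real ger0_norm; last first.
      by rewrite exprn_ge0 // mulr_ge0 //; case/andP: s01.
    have := hK _ Kk; have -> : q / (1 + h) = (s * q) * (1 + h).
      rewrite -[in LHS](mulr1 q) -sp /s; field; apply/eqP; lra.
    rewrite (exprMn _ (s * q) (1 + h)) mulrAC.
    set w := (s * q) ^+ (2 ^ k) * bnorm (a ^+ (2 ^ k)).
    set e := (1 + h) ^+ (2 ^ k) in hn *.
    have w0 : 0 <= w.
      by rewrite mulr_ge0 ?bnorm_ge0 ?exprn_ge0 ?mulr_ge0 //; case/andP: s01.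
    move=> hw; rewrite -(@ler_pM2r _ (3 * bnorm (1 : A))); last lra.
    rewrite mul1r; apply: le_trans hw.
    have -> : w * (8 * bnorm (1 : A)) * (3 * bnorm (1 : A)) =
      w * (24 * bnorm (1 : A) ^+ 2) by ring.
    by apply: ler_wpM2l => //; apply: ltW.
  have z2 : bnorm z <= 2^-1 by have := bnorm_ge0 z; nra.
  have zG : bnorm ((1 - z)^-1 - 1) <= 4^-1.
    have -> : (1 - z)^-1 - 1 = z * (1 - z)^-1.
      have := mulrV (unit_sub1_half z2); set g := _^-1 => <-; ncring.
    apply: (le_trans (bnormM_le _ _)); have := bnorm_inv_half z2.
    have := bnorm_ge0 z; have := bnorm_ge0 (1 - z)^-1; nra.
  move=> GG; have G2 : bnorm (1 - G) <= 2^-1.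
    have -> : 1 - G = - (G - (1 - z)^-1) - ((1 - z)^-1 - 1) by ncring.
    by apply: (le_trans (bnormB_le _ _)); rewrite bnormN; lra.
  have := bnorm_inv_half G2; rewrite subKr /G invrK.
  set t : A := _ *: _ => ht.
  have -> : q ^+ (2 ^ k) * bnorm (a ^+ (2 ^ k)) = bnorm t.
    by rewrite bnormZ -/(modulus _) modulusX modulus_real ger0_norm.
  have -> : t = 1 - (1 - t) by ncring.
  by apply: (le_trans (bnormB_le _ _)); lra.
(* [j] counts the steps up from a radius with q|a| <= 1, where submultiplicativity gives the
   bound. *)
have iter j (q : R) : 0 <= q <= r -> q * bnorm a <= (1 + h) ^+ j ->
    eventually_bounded q.
  elim: j q => [|j IH] q /andP[q0 qr].
    rewrite expr0 => qa; exists 0 => k _.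
    have : q ^+ (2 ^ k) * bnorm (a ^+ (2 ^ k)) <= (q * bnorm a) ^+ (2 ^ k).
      rewrite exprMn; apply: ler_wpM2l; first exact: exprn_ge0.
      by rewrite -(prednK (n := 2 ^ k)) ?expn_gt0 //; apply: bnormX_le.
    have : (q * bnorm a) ^+ (2 ^ k) <= 1.
      by apply: exprn_ile1 => //; rewrite mulr_ge0 ?bnorm_ge0.
    lra.
  have hp : 0 < 1 + h by lra.
  rewrite exprS => qa; apply: step; first by rewrite q0.
  apply: IH; last by rewrite mulrAC ler_pdivrMr // [leRHS]mulrC.
  rewrite divr_ge0 //=; last lra.
  by apply: le_trans qr; rewrite ler_pdivrMr // ler_peMr //; lra.
have [j hj] := pow_unbounded (r * bnorm a) h0.
by apply: (iter j); rewrite ?r0 ?lexx // ltW.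
Qed.

(** Boundedness at radius [2 / e] gives |a^N| <= 3|1|(e/2)^N for large N = 2^k, and 2^N outgrows
    3|1|. *)
Lemma spec0_power_small (e : R) : 0 < e ->
  exists2 n, (0 < n)%N & bnorm (a ^+ n) < e ^+ n.
Proof.
move=> e0; have e2 : 0 <= 2 / e by rewrite divr_ge0 ?ltW ?ler0n.
have [K hK] := dyadic_powers_bounded e2.
have [n hn] := pow_unbounded (3 * bnorm (1 : A)) ltr01.
pose k := maxn K n; exists (2 ^ k)%N; first by rewrite expn_gt0.
have := hK k (leq_maxl _ _); rewrite expr_div_n mulrAC.
rewrite ler_pdivrMr ?exprn_gt0 // => h.
have {}hn : 3 * bnorm (1 : A) < 2 ^+ (2 ^ k).
  apply: (lt_le_trans hn); apply: ler_weXn2l; first lra.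
  by apply: (leq_trans (leq_maxr K n)); apply/ltnW/ltn_expl.
rewrite -(@ltr_pM2l _ (2 ^+ (2 ^ k))) ?exprn_gt0 ?ltr0n //.
by apply: (le_lt_trans h); rewrite ltr_pM2r // exprn_gt0.
Qed.

End Resolvent.
End SpectralRadius.

(** * Quasinilpotent elements *)

Section Quasinilpotent.
Variables (R : realType) (A : banachAlgType R).
Implicit Types (x y z p q : A) (l m : R[i]).

Lemma spec0_powers_mul_small q x : spec0 q ->
  exists2 n, (0 < n)%N & bnorm (q ^+ n) * bnorm (x ^+ n) <= 2^-1.
Proof.
move=> q0; pose e := (2 * (1 + bnorm x))^-1.
have x0 := bnorm_ge0 x.
have e0 : 0 < e by rewrite invr_gt0; lra.
have ex : e * bnorm x <= 2^-1.
  by rewrite /e ler_pdivrMl; lra.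
have [[//|n] _ qn] := spec0_power_small q0 e0; exists n.+1 => //.
apply: (@le_trans _ _ (e ^+ n.+1 * bnorm x ^+ n.+1)).
  by apply: ler_pM; rewrite ?bnorm_ge0 ?bnormX_le // ltW.
have ex0 : 0 <= e * bnorm x by rewrite mulr_ge0 // ltW.
rewrite -exprMn; apply: (le_trans _ ex); rewrite exprS -[leRHS]mulr1.
by apply: ler_wpM2l => //; apply: exprn_ile1 => //; lra.
Qed.

(* The hypothesis makes [(q x)^n = q^n x^n], so some power of [q x] is small. *)
Lemma unit_1sub_spec0_mul q x :
  spec0 q -> q * x * q = q ^+ 2 * x -> 1 - q * x \is a GRing.unit.
Proof.
move=> q0 qxq; have [n n0 hn] := spec0_powers_mul_small x q0.
have E k : (q * x) ^+ k = q ^+ k * x ^+ k.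
  elim: k => [|k IH]; first by rewrite !expr0 mulr1.
  have C j : (q * x) * q ^+ j = q ^+ j.+1 * x.
    elim: j => [|j IHj]; first by rewrite expr0 mulr1 expr1.
    by rewrite exprSr mulrA IHj exprSr -2!mulrA (mulrA q x) qxq expr2 !mulrA -!exprSr.
  by rewrite exprS IH mulrA C -mulrA -exprS.
have U : 1 - (q * x) ^+ n \is a GRing.unit.
  by apply: unit_sub1_half; rewrite E; apply: le_trans (bnormM_le _ _) hn.
have := U; rewrite -[1 - _ ^+ _]opprB subrX1 -mulNr opprB unitrM_comm.
  by case/andP.
apply: commr_sum => i _; apply/commrX/commr_sym.
by apply: commrB; [apply: commr1|].
Qed.

(** Scalars commute with [q]; conversely, any [x] commuting with [q] satisfies
    [q * x * q = q ^+ 2 * x], so [unit_1sub_spec0_mul] applies to [- x]. *)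
Lemma qnilP q : qnil q <-> spec0 q.
Proof.
split=> [q0 l|q0 x xq].
  have := q0 (- l%:A); rewrite mulrN mulr_algr; apply.
  by rewrite /comm /= mulNr mulrN mulr_algl mulr_algr.
rewrite -[q * x]opprK -mulrN; apply: unit_1sub_spec0_mul => //.
by rewrite mulrN mulNr -mulrA [x * q]xq mulrA -expr2 mulrN.
Qed.

Lemma qnil0 : qnil (0 : A).
Proof. by apply/qnilP => l; rewrite scaler0 subr0 unitr1. Qed.

Lemma qnilM q x : qnil q -> q * x = x * q -> qnil (q * x).
Proof.
move=> q0 qx; apply/qnilP => l.
have := q0 (- l *: x); rewrite -scalerAr !scaleNr; apply.
by rewrite /comm /= mulNr mulrN -scalerAl -scalerAr qx.
Qed.

Lemma qnilN q : qnil q -> qnil (- q).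
Proof. by move=> q0; rewrite -mulrN1; apply: qnilM => //; rewrite mulrN1 mulN1r. Qed.

Lemma qnil_of_sqr y : qnil (y ^+ 2) -> qnil y.
Proof.
move=> /qnilP h; apply/qnilP => l; have := h (l ^+ 2).
rewrite -exprZn; set x := _ *: _.
have -> : 1 - x ^+ 2 = (1 - x) * (1 + x) by ncring.
rewrite unitrM_comm; first by case/andP.
by rewrite /GRing.comm; ncring.
Qed.

(** Iteration gives z = x^n z q^n; the powers of the quasinilpotent factor beat the geometric growth
    of the other, so |z| <= |z|/2. *)
Lemma intertwining_eq0 z x q :
  qnil x \/ qnil q -> z = x * z * q -> z = 0.
Proof.
move=> h zE.
have zn n : z = x ^+ n * z * q ^+ n.
  elim: n => [|n IH]; first by rewrite !expr0 mul1r mulr1.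
  by rewrite exprS exprSr !mulrA -(mulrA x) -(mulrA x) -IH -zE.
have [n hn] : exists n, bnorm (x ^+ n) * bnorm (q ^+ n) <= 2^-1.
  case: h => /qnilP h; first by have [n] := spec0_powers_mul_small q h; exists n.
  by have [n] := spec0_powers_mul_small x h; exists n; rewrite mulrC.
apply: bnorm0_eq0.
have : bnorm z <= bnorm (x ^+ n) * bnorm (q ^+ n) * bnorm z.
  rewrite {1}(zn n) mulrAC; apply: (le_trans (bnormM_le _ _)).
  by apply: ler_wpM2r; [apply: bnorm_ge0|apply: bnormM_le].
have := bnorm_ge0 z; nra.
Qed.

End Quasinilpotent.

(** * Lifting idempotents *)

Section IdempotentLift.
Variables (R : realType) (A : banachAlgType R).
Implicit Types (x y z : A).

Local Notation T := ('X - 'X^2 : {poly R[i]}).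

(* Newton's iteration [U' = 3 U^2 - 2 U^3] for the equation [U - U^2 = 0],
   with the factor [T] split off: [U = 'X + T * Y] and [U - U^2 = T * r]. *)
Fixpoint newton k : {poly R[i]} * {poly R[i]} :=
  if k is k.+1 then
    let: (r, Y) := newton k in
    (r * (T * r) * (3%:R + 4%:R * (T * r)), Y + r * (2%:R * ('X + T * Y) - 1))
  else (1, 0).

(** A Newton step sends the residual s = U - U^2 to s^2(3 + 4s). *)
Lemma newton_residual k (U := 'X + T * (newton k).2) :
  U - U ^+ 2 = T * (newton k).1.
Proof.
rewrite /U {U}; elim: k => [|k] /=; first by rewrite mulr0 addr0 mulr1.
case: (newton k) => r Y /= IH; set U := 'X + T * Y.
have -> : 'X + T * (Y + r * (2%:R * U - 1)) = U + (U - U ^+ 2) * (2%:R * U - 1).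
  by rewrite IH /U; ring.
have -> : T * (r * (T * r) * (3%:R + 4%:R * (T * r))) =
  (U - U ^+ 2) ^+ 2 * (3%:R + 4%:R * (U - U ^+ 2)) by rewrite IH; ring.
by ring.
Qed.

Variables (u : A) (t0 : qnil (u - u ^+ 2)).

Local Notation t := (u - u ^+ 2).
Local Notation ev := (horner_alg u).

Lemma comm_horner_alg z p : z * u = u * z -> z * ev p = ev p * z.
Proof.
move=> zu; elim/poly_ind: p => [|p c IH]; first by rewrite rmorph0 mulr0 mul0r.
rewrite rmorphD rmorphM /= horner_algX horner_algC mulrDr mulrDl.
by rewrite (mulrA z) IH -(mulrA _ z u) zu (mulrA _ u z) mulr_algl mulr_algr.
Qed.

Let evT : ev T = t.
Proof. by rewrite rmorphB rmorphXn /= horner_algX. Qed.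

Let degree_ex : exists2 n, (0 < n)%N & bnorm (t ^+ n) < 16^-1 ^+ n.
Proof. by apply: spec0_power_small; [apply/qnilP|rewrite invr_gt0 ltr0n]. Qed.

Let degree := s2val (cid2 degree_ex).
Let degree_gt0 : (0 < degree)%N := s2valP (cid2 degree_ex).
Let degree_lt : bnorm (t ^+ degree) < 16^-1 ^+ degree := s2valP' (cid2 degree_ex).

(* An equivalent norm in which multiplication by the quasinilpotent [t] has
   norm at most [1/16]. *)
Definition rnorm x := \sum_(i < degree) 16 ^+ i * bnorm (t ^+ i * x).

Lemma rnorm_ge0 x : 0 <= rnorm x.
Proof. by apply: sumr_ge0 => i _; rewrite mulr_ge0 ?bnorm_ge0 // exprn_ge0. Qed.

Lemma rnorm_ge x : bnorm x <= rnorm x.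
Proof.
rewrite /rnorm -(prednK degree_gt0) big_ord_recl expr0 mul1r expr0 mul1r lerDl.
by apply: sumr_ge0 => i _; rewrite mulr_ge0 ?bnorm_ge0 // exprn_ge0.
Qed.

Lemma rnormD x y : rnorm (x + y) <= rnorm x + rnorm y.
Proof.
rewrite /rnorm -big_split /=; apply: ler_sum => i _.
rewrite -mulrDr (mulrDr (t ^+ i)); apply: ler_wpM2l; first by rewrite exprn_ge0.
exact: bnormD_le.
Qed.

Lemma rnormMn x n : rnorm (x *+ n) <= n%:R * rnorm x.
Proof.
rewrite mulr_sumr; apply: ler_sum => i _; rewrite mulrnAr mulrCA.
by apply: ler_wpM2l; [rewrite exprn_ge0|apply: bnormMn].
Qed.

(** The factor 16 and the multiplication by [t] shift the summation index; the term entering at the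
    top is at most |x|, the one leaving at the bottom. *)
Lemma rnorm_mul_t x : rnorm (t * x) <= 16^-1 * rnorm x.
Proof.
suff : 16 * rnorm (t * x) <= rnorm x by lra.
rewrite {1}/rnorm mulr_sumr.
have -> : rnorm x = \sum_(0 <= i < degree) 16 ^+ i * bnorm (t ^+ i * x).
  by rewrite big_mkord.
have -> : \sum_(i < degree) 16 * (16 ^+ i * bnorm (t ^+ i * (t * x))) =
   \sum_(0 <= i < degree) (16 ^+ i.+1 * bnorm (t ^+ i.+1 * x)).
  by rewrite big_mkord; apply: eq_bigr => i _; rewrite mulrA -exprS mulrA -exprSr.
have -> : \sum_(0 <= i < degree) (16 ^+ i.+1 * bnorm (t ^+ i.+1 * x)) =
  \sum_(0 <= i < degree) (16 ^+ i * bnorm (t ^+ i * x)) +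
   (16 ^+ degree * bnorm (t ^+ degree * x) - 16 ^+ 0 * bnorm (t ^+ 0 * x)).
  rewrite -(@telescope_sumr _ 0 degree (fun i => 16 ^+ i * bnorm (t ^+ i * x))) //.
  by rewrite -big_split /=; apply: eq_bigr => i _; ring.
rewrite gerDl subr_le0 !expr0 !mul1r.
have := bnormM_le (t ^+ degree) x => h.
have h2 := ler_wpM2r (bnorm_ge0 x) (ltW degree_lt).
apply: (@le_trans _ _ (16 ^+ degree * (16^-1 ^+ degree * bnorm x))).
  by apply: ler_wpM2l; [rewrite exprn_ge0|apply: le_trans h h2].
by rewrite mulrA -exprMn mulfV ?pnatr_eq0 // expr1n mul1r.
Qed.

(** These are values at [u] of polynomials, so they commute with all that commutes with [u]; [w k]
    is 2U - 1 for the iterate U = [u + t * Y k]. *)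
Let r k := ev (newton k).1.
Let Y k := ev (newton k).2.
Let w k := (u + t * Y k) *+ 2 - 1.

Let rS k : r k.+1 = r k * (t * r k) * (3%:R + (t * r k) *+ 4).
Proof.
rewrite /r /=; case: (newton k) => r' Y' /=.
(* The polynomial is abstracted so that the morphism rules do not expand it. *)
move: ('X - 'X^2 : {poly _}) evT => T' <-.
by do ![rewrite (rmorph_nat ev) mulr_natl | rewrite (rmorph_nat ev) |
  rewrite (rmorphM ev) /= | rewrite (rmorphD ev) /=].
Qed.

Let YS k : Y k.+1 = Y k + r k * w k.
Proof.
rewrite /w /Y /r /=; case: (newton k) => r' Y' /=.
move: ('X - 'X^2 : {poly _}) evT => T' <-.
do ![rewrite (rmorph_nat ev) mulr_natl | rewrite (rmorphB ev) (rmorph1 ev) /= |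
  rewrite (rmorphM ev) /= | rewrite (rmorphD ev) /=].
by rewrite horner_algX.
Qed.

(** In [rnorm], multiplication by [t * r k] has norm at most 1/16 and by [3 + 4 t r_k] at most 4,
    which gives a factor 1/4 per step. *)
Let rnorm_r k x : rnorm (r k * x) <= 4^-1 ^+ k * rnorm x.
Proof.
have p k' : 0 <= (4^-1 : R) ^+ k' <= 1.
  by rewrite exprn_ge0 ?invr_ge0 //= exprn_ile1 ?invr_ge0 // invf_le1 // ler1n.
elim: k x => [|k IH] x; first by rewrite /r /= rmorph1 !mul1r.
have tr z : rnorm (t * r k * z) <= 16^-1 * (4^-1 ^+ k * rnorm z).
  rewrite -(mulrA t); apply: (le_trans (rnorm_mul_t _)).
  by rewrite ler_pM2l ?invr_gt0.
rewrite rS -(mulrA _ _ x) -(mulrA (r k)); apply: (le_trans (IH _)).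
rewrite [_ ^+ k.+1]exprSr -[leRHS]mulrA; apply: ler_wpM2l; first by case/andP: (p k).
apply: (le_trans (tr _)).
have -> : (3%:R + (t * r k) *+ 4) * x = x *+ 3 + (t * r k * x) *+ 4.
  by rewrite mulrDl mulr_natl mulrnAl.
have := rnormD (x *+ 3) ((t * r k * x) *+ 4).
have := rnormMn x 3; have := rnormMn (t * r k * x) 4; have := tr x.
have := rnorm_ge0 x; have /andP[] := p k.
set N := rnorm (_ + _); set q := _ ^+ k => q0 q1 x0 h1 h2 h3 h4.
have h5 : q * rnorm x <= rnorm x by nra.
have h6 : N <= 4 * rnorm x by lra.
have : q * N <= 4 * rnorm x.
  by have := rnorm_ge0 ((x *+ 3) + (t * r k * x) *+ 4); rewrite -/N; nra.
lra.
Qed.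

(** Each step multiplies the norm by at most 1 + 2/16; the cruder 2 suffices for the increments
    [r k * w k] of [Y] to decay like 2^-k. *)
Let rnorm_w k : rnorm (w k) <= 2 ^+ k * rnorm (w 0).
Proof.
elim: k => [|k IH]; first by rewrite expr0 mul1r.
have -> : w k.+1 = w k + (t * (r k * w k)) *+ 2.
  by rewrite /w YS mulrDr addrA mulrnDl addrAC.
apply: (le_trans (rnormD _ _)).
have := rnormMn (t * (r k * w k)) 2; have := rnorm_mul_t (r k * w k).
have := rnorm_r k (w k); rewrite [2 ^+ k.+1]exprS.
have : (4^-1 : R) ^+ k <= 1.
  by rewrite exprn_ile1 ?invr_ge0 // invf_le1 // ler1n.
have := rnorm_ge0 (w k).
set q := 4^-1 ^+ k; set W := rnorm (w k) in IH *; set p := 2 ^+ k in IH *.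
move=> W0 q1; have : q * W <= W by nra.
lra.
Qed.

Lemma idempotent_lift : exists Y : A,
  (forall z, z * u = u * z -> z * Y = Y * z) /\
  (u + t * Y) ^+ 2 = u + t * Y.
Proof.
have quarter k : (4^-1 : R) ^+ k * 2 ^+ k = 2^-1 ^+ k.
  by rewrite -exprMn; congr (_ ^+ _); lra.
have [|Z YZ] := @gcvg_of_increments _ _ Y (rnorm (w 0)).
  move=> k; rewrite YS addrAC subrr add0r; apply: (le_trans (rnorm_ge _)).
  apply: (le_trans (rnorm_r _ _)); rewrite -quarter [leRHS]mulrCA.
  apply: ler_wpM2l; first by rewrite exprn_ge0 // invr_ge0.
  by rewrite mulrC; apply: rnorm_w.
exists Z; split=> [z zu|].
  by apply/esym/(comm_gcvg (u := Y)) => // k; rewrite -comm_horner_alg.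
have UZ : gcvg (fun k => u + t * Y k) (u + t * Z).
  by apply: gcvgD; [apply: gcvg_cst|apply: gcvgM => //; apply: gcvg_cst].
(* The residuals tend to 0, so the limit is an exact idempotent. *)
have : gcvg (fun k => t * r k) 0.
  exists (rnorm 1) => k; rewrite subr0; apply: (le_trans (rnorm_ge _)).
  apply: (le_trans (rnorm_mul_t _)).
  have := rnorm_r k 1; rewrite mulr1 => h.
  have : (4^-1 : R) ^+ k <= 2^-1 ^+ k by apply: lerXn2r; rewrite ?nnegrE; lra.
  have := rnorm_ge0 1; have := rnorm_ge0 (r k); nra.
have resid k : (u + t * Y k) - (u + t * Y k) ^+ 2 = t * r k.
  have /(congr1 ev) := newton_residual k.
  move: ('X - 'X^2 : {poly _}) evT => T' <-.
  rewrite (rmorphB ev) (rmorphXn ev) /= (rmorphD ev) /= !(rmorphM ev) /=.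
  by rewrite horner_algX.
move=> h0; apply/esym/eqP; rewrite -subr_eq0; apply/eqP.
apply: gcvg_unique h0; apply: (gcvg_ext resid).
apply: gcvgD => //; apply: gcvgN; rewrite expr2.
apply: (gcvg_ext (u := fun k => (u + t * Y k) * (u + t * Y k))) => [k|].
  by rewrite expr2.
exact: gcvgM.
Qed.

End IdempotentLift.

(** * Generalized Hirano and g-Drazin inverses *)

Section GeneralizedInverses.
Variables (R : realType) (A : banachAlgType R).
Implicit Types (a b d e x y z : A).

(** With [q = a^2 - e] one has [a^2 e = e (1 + q e)], and [1 + q e] is invertible; so [a e] is
    invertible in the corner [e A e], with inverse [a e (1 + q e)^-1]. *)
Lemma inverse_in_corner a e : e ^+ 2 = e -> e * a = a * e ->
  qnil (a ^+ 2 - e) -> exists b, [/\ comm a b, b = b * a * b & a * b = e].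
Proof.
move=> ee ea q0; set q := a ^+ 2 - e in q0.
have {}ee : e * e = e by rewrite -expr2.
have aq : a * q = q * a by rewrite /q mulrBr mulrBl ea -exprS -exprSr.
have eq : e * q = q * e.
  by rewrite /q mulrBr mulrBl expr2 mulrA ea -mulrA ea mulrA.
have U : 1 + q * e \is a GRing.unit by apply: q0; rewrite /comm /= eq.
pose v := (1 + q * e)^-1.
have va : v * a = a * v.
  apply/esym/commrV; apply: commrD; first exact: commr1.
  by rewrite /GRing.comm mulrA aq -mulrA -ea mulrA.
have ve : v * e = e * v.
  apply/esym/commrV; apply: commrD; first exact: commr1.
  by rewrite /GRing.comm mulrA eq.
have aaE : a * a = e + q by rewrite /q expr2 addrC subrK.
have abE : a * (a * e * v) = e.
  have -> : a * (a * e * v) = (a * a) * e * v by ncring.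
  have -> : a * a * e = e * (1 + q * e).
    by rewrite aaE mulrDl mulrDr mulr1 ee mulrA eq -mulrA ee.
  by rewrite -mulrA mulrV ?mulr1.
have baE : (a * e * v) * a = a * (a * e * v).
  by rewrite -mulrA va mulrA -(mulrA a e a) ea !mulrA.
exists (a * e * v); split => //.
by rewrite -(mulrA (a * e * v)) abE -(mulrA _ v e) ve mulrA -(mulrA a e e) ee.
Qed.

Lemma gHirano_idempotent a b : comm a b -> b = b * a * b ->
  (a * b) ^+ 2 = a * b /\ (a * b) * a = a * (a * b).
Proof.
rewrite /comm /= => ba bab; split; first by rewrite expr2 -mulrA (mulrA b) -bab.
by rewrite -mulrA ba.
Qed.

(** Forwards, with [e = a b] and [q = a^2 - e], the square of [a - a^3] is
    [q (1 - 2 e - q) (1 - a^2)]. Backwards, [a^2 - a^4 = (a - a^3) a] is quasinilpotent, so [a^2] is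
    close to an idempotent [e], and [a] is inverted in its corner. *)
Lemma gHiranoP a : has_gHirano_inverse a <-> qnil (a - a ^+ 3).
Proof.
split=> [[b [ba bab q0]]|h].
  have [ee ea] := gHirano_idempotent ba bab.
  move: ee ea q0; set e := a * b => ee ea q0.
  set q := a ^+ 2 - e in q0.
  have a2E : a ^+ 2 = e + q by rewrite /q addrC subrK.
  have aq : a * q = q * a by rewrite /q mulrBr mulrBl ea -exprS -exprSr.
  have eq : e * q = q * e.
    by rewrite /q mulrBr mulrBl expr2 mulrA ea -mulrA ea mulrA.
  apply: qnil_of_sqr.
  have -> : (a - a ^+ 3) ^+ 2 = q * ((1 - e - e - q) * (1 - a ^+ 2)).
    have -> : (a - a ^+ 3) ^+ 2 = (a ^+ 2 - a ^+ 2 * a ^+ 2) * (1 - a ^+ 2).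
      by ncring.
    rewrite [RHS]mulrA; congr (_ * (1 - _)); rewrite a2E.
    transitivity (e - e ^+ 2 + q - e * q - q * e - q ^+ 2); first by ncring.
    by rewrite ee eq; ncring.
  apply: qnilM => //; apply: commrM; last first.
    by apply: commrB; [apply: commr1|apply/commrX/commr_sym].
  by do !apply: commrB => //; apply: commr1.
have h2 : qnil (a ^+ 2 - (a ^+ 2) ^+ 2).
  have -> : a ^+ 2 - (a ^+ 2) ^+ 2 = (a - a ^+ 3) * a by ncring.
  by apply: qnilM => //; ncring.
have [Y [hY ee]] := idempotent_lift h2.
set t := a ^+ 2 - _ in h2 hY ee; set e := _ + _ in ee.
have aY : a * Y = Y * a by apply: hY; ncring.
have at_ : a * t = t * a by rewrite /t; ncring.
have tY : qnil (t * Y).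
  by apply: qnilM => //; apply: hY; rewrite /t; ncring.
have a2e : a ^+ 2 - e = - (t * Y) by rewrite /e opprD addrA subrr add0r.
have ea : e * a = a * e.
  by rewrite /e mulrDl mulrDr -exprS -exprSr -mulrA -aY mulrA -at_ mulrA.
have [|b [ab bab abE]] := inverse_in_corner ee ea; first by rewrite a2e; apply: qnilN.
by exists b; split => //; rewrite abE a2e; apply: qnilN.
Qed.

(** The corner inverse [d] for [e = a b] qualifies, because [a - a^2 d = a - a e] has square
    [(a^2 - e) (1 - e)]. *)
Lemma gDrazinP a : has_gHirano_inverse a -> is_gDrazin_inverse a (gDrazin a).
Proof.
move=> [b [ba bab q0]].
have [ee ea] := gHirano_idempotent ba bab.
have [d [ad dad adE]] := inverse_in_corner ee ea q0.
suff : is_gDrazin_inverse a d by move=> h; apply: xgetPex; exists d.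
split=> //; rewrite expr2 -mulrA adE; move: ee ea q0 adE.
set e := a * b => ee ea q0 adE.
have {}ee : e * e = e by rewrite -expr2.
apply: qnil_of_sqr.
have -> : (a - a * e) ^+ 2 = (a ^+ 2 - e) * (1 - e).
  transitivity (a * a - a * a * e - a * (e * a) + a * (e * a) * e); first by ncring.
  rewrite ea; transitivity (a * a - a * a * e - a * a * e + a * a * (e * e)).
    by ncring.
  by rewrite ee; transitivity (a * a - a * a * e - e + e * e); [rewrite ee|]; ncring.
apply: qnilM => //; apply: commrB; first exact: commr1.
apply: commr_sym; apply: commrB => //; first exact: commrX.
Qed.

(** For the idempotent [e = a d], the off-diagonal parts of [y] are intertwined by [d] and the
    quasinilpotent [p], hence vanish; so [y] commutes with [e], and then with [d], the inverse of
    [a] in the corner of [e]. *)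
Lemma gDrazin_bicomm a d y : is_gDrazin_inverse a d -> y * a = a * y -> y * d = d * y.
Proof.
move=> [da dad p0] ya; rewrite /comm /= in da.
set p := a - _ in p0.
pose e := a * d.
have de : d * e = d by rewrite /e mulrA -dad.
have ed : e * d = d by rewrite /e -da -dad.
have ee : e * e = e by rewrite /e -mulrA de.
have pE : p = a * (1 - e) by rewrite /p /e; ncring.
have ae : a * e = e * a by rewrite /e -(mulrA a d a) da.
have pE' : p = (1 - e) * a by rewrite pE mulrBr mulrBl ae mulr1 mul1r.
have e1 : (1 - e) * (1 - e) = 1 - e.
  by transitivity (1 - e - e + e * e); [|rewrite ee]; ncring.
have pl : (1 - e) * p = p by rewrite pE' mulrA e1.
have pr : p * (1 - e) = p by rewrite pE -mulrA e1.
have z1 : e * y * (1 - e) = 0.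
  apply: (@intertwining_eq0 _ _ _ d p); first by right.
  transitivity ((d * e) * y * ((1 - e) * p)); last by ncring.
  rewrite de pl pE; transitivity (d * (y * a) * (1 - e)); last by ncring.
  by rewrite ya mulrA da.
have z2 : (1 - e) * y * e = 0.
  apply: (@intertwining_eq0 _ _ _ p d); first by left.
  transitivity ((p * (1 - e)) * y * (e * d)); last by ncring.
  rewrite pr ed pE'; transitivity ((1 - e) * (a * y) * d); last by ncring.
  by rewrite -ya /e; ncring.
have eye1 : e * y = e * y * e by apply/eqP; rewrite -subr_eq0 -z1; apply/eqP; ncring.
have eye2 : y * e = e * y * e by apply/eqP; rewrite -subr_eq0 -z2; apply/eqP; ncring.
have ey : e * y = y * e by rewrite eye1 -eye2.
transitivity (y * (e * d)); first by rewrite ed.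
transitivity (d * (a * y) * d); last first.
  by rewrite -ya; transitivity (d * (y * e)); [rewrite /e; ncring|rewrite -ey mulrA de].
by rewrite mulrA -ey /e -da; ncring.
Qed.

End GeneralizedInverses.

(** * The Jacobson radical of an inverse-closed subalgebra *)

Section Radical.
Variables (R : realType) (A : banachAlgType R).
Implicit Types (a b c d x y z q : A) (l m : R[i]).

(** [x^-1] is [x] itself for a non-unit, so [icl_inv] adds genuine inverses only. *)
Inductive inverse_closure (S : A -> Prop) : A -> Prop :=
| icl_gen x : S x -> inverse_closure S x
| icl_scalar l : inverse_closure S l%:A
| icl_add x y : inverse_closure S x -> inverse_closure S y ->
    inverse_closure S (x + y)
| icl_mul x y : inverse_closure S x -> inverse_closure S y ->
    inverse_closure S (x * y)
| icl_inv x : inverse_closure S x -> inverse_closure S x^-1.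

(** * Commutators in the right ideal [c A] *)

Definition eigen c x := exists l, x * c = l *: c.

Definition commute_mod c x y := exists w, x * y - y * x = c * w.

Lemma commute_modC c x y : commute_mod c x y -> commute_mod c y x.
Proof. by move=> [w e]; exists (- w); rewrite mulrN -e opprB. Qed.

Lemma eigenV c x : x \is a GRing.unit -> eigen c x -> eigen c x^-1.
Proof.
move=> U [l e]; have [l0|l0] := eqVneq l 0.
  have -> : c = 0 by rewrite -[c]mul1r -(mulVr U) -mulrA e l0 scale0r mulr0.
  by exists 0; rewrite mulr0 scaler0.
exists l^-1; rewrite -[c in LHS](scale1r c) -(mulVf l0) -scalerA -e.
by rewrite -scalerAr mulrA mulVr // mul1r.
Qed.

Lemma eigen_closure (S : A -> Prop) c :
  (forall x, S x -> eigen c x) -> forall x, inverse_closure S x -> eigen c x.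
Proof.
move=> hS x; elim=> [{}x Sx|l|{}x y _ [l el] _ [m em]|{}x y _ [l el] _ [m em]|{}x _ h].
- exact: hS.
- by exists l; rewrite mulr_algl.
- by exists (l + m); rewrite mulrDl el em scalerDl.
- by exists (l * m); rewrite -mulrA em -scalerAr el scalerA mulrC.
- by have [U|U] := boolP (x \is a GRing.unit); [apply: eigenV|rewrite invr_out].
Qed.

(** The right ideal [c A] is stable under left multiplication by the closure, which acts on [c] by
    scalars; the rules for [[x y, z]] and [[x^-1, z]] then stay inside it. *)
Lemma commute_mod_closure_gen (S : A -> Prop) c z :
  (forall x, S x -> eigen c x) -> (forall x, S x -> commute_mod c x z) ->
  forall x, inverse_closure S x -> commute_mod c x z.
Proof.
move=> eS cS x.
elim=> [{}x Sx|l|{}x y Bx [v ev] By [w ew]|{}x y Bx [v ev] By [w ew]|{}x Bx [v ev]].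
- exact: cS.
- by exists 0; rewrite mulr_algl mulr_algr subrr mulr0.
- exists (v + w); rewrite (mulrDr c) -ev -ew; ncring.
- have [l el] := eigen_closure eS Bx.
  exists (l *: w + v * y).
  have -> : x * y * z - z * (x * y) = x * (y * z - z * y) + (x * z - z * x) * y.
    by ncring.
  by rewrite ev ew mulrA el mulrDr -scalerAr -scalerAl mulrA.
have [U|U] := boolP (x \is a GRing.unit); last by exists v; rewrite invr_out.
have [m em] := eigen_closure eS (icl_inv Bx).
exists (- (m *: (v * x^-1))).
have -> : x^-1 * z - z * x^-1 = - (x^-1 * (x * z - z * x) * x^-1).
  rewrite mulrBr mulrBl mulrA mulVr // mul1r -(mulrA x^-1) -(mulrA z x) mulrV // mulr1.
  by rewrite opprB.
by rewrite ev mulrA em mulrN -scalerAl -scalerAl -scalerAr mulrA.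
Qed.

Lemma commute_mod_closure (S : A -> Prop) c :
  (forall x, S x -> eigen c x) -> (forall x y, S x -> S y -> commute_mod c x y) ->
  forall x y, inverse_closure S x -> inverse_closure S y -> commute_mod c x y.
Proof.
move=> eS cS x y Bx By; apply/commute_modC.
apply: (commute_mod_closure_gen eS) => // z Sz.
apply/commute_modC/(commute_mod_closure_gen eS _ Bx) => w Sw.
exact: cS.
Qed.

(** * The radical as a two-sided ideal *)

Variable S : A -> Prop.
Local Notation B := (inverse_closure S).

(** The quasi-regularity description of the Jacobson radical of [B]; units of [A] lying in [B] are
    units of [B] by inverse-closedness. *)
Definition radical x := B x /\ forall y, B y -> 1 - x * y \is a GRing.unit.

Lemma icl1 : B 1.
Proof. by rewrite -(scale1r 1); apply: icl_scalar. Qed.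

Lemma icl_scale l x : B x -> B (l *: x).
Proof. by rewrite -mulr_algl; apply/icl_mul/icl_scalar. Qed.

Lemma icl_opp x : B x -> B (- x).
Proof. by rewrite -scaleN1r; apply: icl_scale. Qed.

Lemma icl_sub x y : B x -> B y -> B (x - y).
Proof. by move=> Bx By; apply/icl_add/icl_opp. Qed.

Lemma icl_exp x n : B x -> B (x ^+ n).
Proof.
move=> Bx; elim: n => [|n IH]; first by rewrite expr0; apply: icl1.
by rewrite exprS; apply: icl_mul.
Qed.

Lemma radicalMr x y : radical x -> B y -> radical (x * y).
Proof.
move=> [Bx Jx] By; split=> [|z Bz]; first exact: icl_mul.
by rewrite -mulrA; apply/Jx/icl_mul.
Qed.

(** The inverse is [1 + y (1 - x y)^-1 x]. *)
Lemma unit_1subC x y : 1 - x * y \is a GRing.unit -> 1 - y * x \is a GRing.unit.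
Proof.
move=> U; set v := (1 - x * y)^-1.
have v1 : v - v * x * y = 1 by rewrite -mulrA -[X in X - _]mulr1 -mulrBr mulVr.
have v2 : v - x * y * v = 1 by rewrite -[X in X - _]mul1r -mulrBl mulrV.
apply: (@unitrP2 _ _ _ (1 + y * v * x)).
  transitivity (1 - y * x + y * (v - x * y * v) * x); first by ncring.
  by rewrite v2; ncring.
transitivity (1 - y * x + y * (v - v * x * y) * x); first by ncring.
by rewrite v1; ncring.
Qed.

Lemma radicalMl x y : radical x -> B y -> radical (y * x).
Proof.
move=> [Bx Jx] By; split=> [|z Bz]; first exact: icl_mul.
by rewrite -mulrA; apply/unit_1subC; rewrite -mulrA; apply/Jx/icl_mul.
Qed.

(** After factoring out [1 - x z], its inverse, which lies in [B], is moved to the right of [y z] by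
    [unit_1subC]. *)
Lemma radicalD x y : radical x -> radical y -> radical (x + y).
Proof.
move=> [Bx Jx] [By Jy]; split=> [|z Bz]; first exact: icl_add.
have U := Jx z Bz.
have -> : 1 - (x + y) * z = (1 - x * z) * (1 - (1 - x * z)^-1 * (y * z)).
  by rewrite mulrBr mulr1 mulrA mulrV // mul1r; ncring.
rewrite unitrMl //; apply: unit_1subC; rewrite -mulrA; apply: Jy.
apply: icl_mul => //; apply/icl_inv/icl_sub; [exact: icl1|exact: icl_mul].
Qed.

Lemma radicalZ l x : radical x -> radical (l *: x).
Proof. by rewrite -mulr_algl => Jx; apply: radicalMl => //; apply: icl_scalar. Qed.

Lemma radicalN x : radical x -> radical (- x).
Proof. by rewrite -scaleN1r; apply: radicalZ. Qed.

Lemma radicalB x y : radical x -> radical y -> radical (x - y).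
Proof. by move=> Jx Jy; apply/radicalD/radicalN. Qed.

Lemma radicalMn x n : radical (x *+ n.+1) <-> radical x.
Proof.
rewrite -scaler_nat; split=> [h|]; last exact: radicalZ.
rewrite -(scale1r x) -(@mulVf _ n.+1%:R) ?pnatr_eq0 // -scalerA.
exact: radicalZ.
Qed.

Lemma qnil_of_radical x : radical x -> qnil x.
Proof.
move=> [_ h]; apply/qnilP => l.
by rewrite -mulr_algr; apply: h; apply: icl_scalar.
Qed.

(** * Quasinilpotents and cubes modulo the radical *)

Variable c : A.
Hypothesis eigenS : forall x, S x -> eigen c x.
Hypothesis commS : forall x y, S x -> S y -> commute_mod c x y.

(* A quasinilpotent [q] acts on the left on [c] by a scalar, which must be [0];
   so [q [x, q] = 0] for all [x] in the subalgebra. *)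
Lemma radical_of_qnil q : B q -> qnil q -> radical q.
Proof.
move=> Bq q0; split=> // x Bx; apply: unit_1sub_spec0_mul; first exact/qnilP.
have qc : q * c = 0.
  have [l e] := eigen_closure eigenS Bq.
  have [l0|l0] := eqVneq l 0; first by rewrite e l0 scale0r.
  (* The unit [1 - l^-1 q] kills [c], which forces [c = 0]. *)
  have U := (qnilP q).1 q0 l^-1.
  have -> : c = 0; last by rewrite mulr0.
  rewrite -[c]mul1r -(mulVr U) -mulrA mulrBl mul1r -scalerAl e scalerA.
  by rewrite mulVf // scale1r subrr mulr0.
have [w ew] := commute_mod_closure eigenS commS Bx Bq.
apply/eqP; rewrite -subr_eq0; apply/eqP.
transitivity (q * (x * q - q * x)); first by ncring.
by rewrite ew mulrA qc mul0r.
Qed.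

(** Modulo the radical the two sides are [-3 X] and [-3 Y], where [Y = (a b)^2 + a b]; moreover
    [a X] is congruent to [Y] and [a Y] to [X]. *)
Lemma radical_cube a b d : B a -> B b -> radical c -> c = a * b - b * a ->
  a ^+ 2 * b = a * b * a -> b ^+ 2 * a = b * a * b ->
  radical (a - a ^+ 3) -> radical (b - b ^+ 3) -> radical (d - a) ->
  radical (a + b - (a + b) ^+ 3) <-> radical (1 + d * b - (1 + d * b) ^+ 3).
Proof.
move=> Ba Bb Jc cE aab bba Ja Jb Jd.
pose X := a * a * b + a * b * b; pose v := a * b.
have equivD x y z : radical z -> x = y + z -> (radical x <-> radical y).
  move=> Jz ->; split=> [h|h]; last exact: radicalD.
  by rewrite -(addrK z y); apply: radicalB.
have equivN x : radical (- x) <-> radical x.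
  by split=> [/radicalN|/radicalN //]; rewrite opprK.
have {}aab : a * b * a = a * a * b by rewrite -aab expr2.
have {}bba : b * b * a = b * a * b by rewrite -bba expr2.
have ba : b * a = a * b - c by rewrite cE; ncring.
have sX : radical (a + b - (a + b) ^+ 3) <-> radical X.
  rewrite -(radicalMn X 2) -(equivN (X *+ 3)).
  apply: (equivD _ _ ((a - a ^+ 3) + (b - b ^+ 3) + c * (a + b + b))).
    apply: radicalD; first exact: radicalD.
    by apply: radicalMr => //; do !apply: icl_add.
  rewrite 3!mulrS mulr0n cE /X.
  transitivity (a + b - a ^+ 3 - b ^+ 3 - a * a * b - a * b * a - b * a * a -
    a * b * b - b * a * b - b * b * a); first by ncring.
  rewrite bba; transitivity (a + b - a ^+ 3 - b ^+ 3 - a * a * b - a * b * a *+ 2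
    + (a * b - b * a) * a - a * b * b - (a * b * b) *+ 2
    + ((a * b - b * a) * b) *+ 2).
    by rewrite !mulrS !mulr0n; ncring.
  by rewrite aab !mulrS !mulr0n; ncring.
pose Y := v * v + v.
have vB : B v by apply: icl_mul.
have tY : radical (1 + d * b - (1 + d * b) ^+ 3) <-> radical Y.
  have Bd : B d by rewrite -(subrK a d); apply: icl_add => //; case: Jd.
  have B1 := icl1.
  pose t := 1 + d * b; pose t' := 1 + a * b; pose e := (d - a) * b.
  have Je : radical e by apply: radicalMr.
  have Bt : B t by apply/icl_add/icl_mul.
  have Bt' : B t' by apply/icl_add/icl_mul.
  (* The two relations give [(a b)^3 = a^3 b^3], so [v^3 - v] lies in the radical. *)
  have v3 : v ^+ 3 - v = - ((a - a ^+ 3) * b ^+ 3 + a * (b - b ^+ 3)).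
    have bab : b * a * b * b = b * b * a * b by rewrite bba.
    have -> : v ^+ 3 = a ^+ 3 * b ^+ 3; last by rewrite /v; ncring.
    transitivity (a * b * a * (b * a * b)); first by rewrite /v; ncring.
    rewrite aab -bba.
    transitivity (a * (a * b * (b * b * a))); first by ncring.
    rewrite bba; transitivity (a * (a * (b * b * a) * b)); first by ncring.
    rewrite bba; transitivity (a * (a * b * a) * b * b); first by ncring.
    by rewrite aab; ncring.
  rewrite -(radicalMn Y 2) -(equivN (Y *+ 3)).
  (* Here [e = t - t'], and [t^3 - t'^3 = e t^2 + t' e t + t'^2 e]: these terms replace [d] by
     [a]. *)
  apply: (equivD _ _ (e - e * t ^+ 2 - t' * e * t - t' ^+ 2 * e +
     ((a - a ^+ 3) * b ^+ 3 + a * (b - b ^+ 3)))).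
    apply: radicalD; last first.
      by apply: radicalD; [apply: radicalMr|apply: radicalMl] => //; apply: icl_exp.
    do !apply: radicalB => //.
    + by apply: radicalMr => //; apply: icl_exp.
    + by apply: radicalMr => //; apply: radicalMl.
    + by apply: radicalMl => //; apply: icl_exp.
  rewrite -[(a - _) * _ + _]opprK -v3 /Y /t /t' /e /v 3!mulrS mulr0n.
  ncring.
have XY : radical X <-> radical Y.
  split=> [JX|JY].
    have -> : Y = a * X + (a - a ^+ 3) * b.
      rewrite /Y /X /v; transitivity (a * b * a * b + a * b); first by ncring.
      by rewrite aab; ncring.
    by apply: radicalD; [apply: radicalMl|apply: radicalMr].
  have -> : X = a * Y + (a - a ^+ 3) * (b * b).
    rewrite /Y /X /v; transitivity (a * a * b + a * b * b); first by ncring.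
    transitivity (a * (a * b * a) * b + a * a * b + (a - a ^+ 3) * (b * b));
      last by ncring.
    by rewrite aab; ncring.
  by apply: radicalD; [apply: radicalMl|apply: radicalMr => //; apply: icl_mul].
by rewrite sX tY.
Qed.

End Radical.

(** * The subalgebra generated by [a], [b] and the g-Drazin inverse of [a] *)

Theorem theorem4p3 (R : realType) (A : banachAlgType R) (a b : A)
    (ha : has_gHirano_inverse a) (hb : has_gHirano_inverse b)
    (hab : a ^+ 2 * b = a * b * a) (hba : b ^+ 2 * a = b * a * b) :
  has_gHirano_inverse (a + b) <-> has_gHirano_inverse (1 + gDrazin a * b).
Proof.
have hd := gDrazinP ha; move: (gDrazin a) hd => d hd.
have [da dad p0] := hd; rewrite /comm /= in da.
pose c := a * b - b * a.
pose S x := [\/ x = a, x = b | x = d].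
(* By [hab], [a b] commutes with [a], hence with [d] by the double commutant property. *)
have dab : d * (a * b) = a * b * d.
  apply/esym/(gDrazin_bicomm hd); rewrite -hab; ncring.
have ac : a * c = 0.
  by rewrite /c; transitivity (a ^+ 2 * b - a * b * a); [ncring|rewrite hab subrr].
have bc : b * c = 0.
  by rewrite /c; transitivity (b * a * b - b ^+ 2 * a); [ncring|rewrite hba subrr].
have ddc : d = d * d * a by rewrite {1}dad -!mulrA da.
have dc : d * c = 0 by rewrite ddc -mulrA ac mulr0.
(* Both products end in [d^2]: [d b = a b d^2] and [b d = b a d^2]. *)
have bd : b * d - d * b = c * - (d * d).
  have db : d * b = a * b * d * d.
    by rewrite {1}ddc -(mulrA _ a b) -(mulrA d d) dab mulrA dab.
  have bd : b * d = b * a * d * d.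
    by rewrite {1}dad da -!mulrA.
  by rewrite db bd /c; ncring.
have eigS x : S x -> eigen c x.
  by case=> ->; exists 0; rewrite scale0r.
have cm0 x y : x * y = y * x -> commute_mod c x y.
  by move=> e; exists 0; rewrite e subrr mulr0.
have cab : commute_mod c a b by exists 1; rewrite mulr1.
have cbd : commute_mod c b d by exists (- (d * d)).
have cad : commute_mod c a d by apply: cm0.
have comS x y : S x -> S y -> commute_mod c x y.
  by do 2!case=> ->; try exact: cm0; try done; apply/commute_modC.
pose B := inverse_closure S.
have Ba : B a by apply/icl_gen/Or31.
have Bb : B b by apply/icl_gen/Or32.
have Bd : B d by apply/icl_gen/Or33.
have cube x : B x -> has_gHirano_inverse x <-> radical S (x - x ^+ 3).
  move=> Bx; rewrite gHiranoP; split; last exact: qnil_of_radical.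
  apply: (radical_of_qnil eigS comS).
  by apply: icl_sub => //; apply: icl_exp.
have Jc : radical S c.
  apply: (radical_of_qnil eigS comS).
    by apply: icl_sub; apply: icl_mul.
  (* [c^2 = a (b c) - b (a c) = 0]. *)
  apply: qnil_of_sqr; have -> : c ^+ 2 = 0; last exact: qnil0.
  by rewrite expr2 {1}/c mulrBl -!mulrA ac bc !mulr0 subrr.
have Jp : radical S (a - a ^+ 2 * d).
  apply: (radical_of_qnil eigS comS) => //.
  by apply: icl_sub => //; apply: icl_mul => //; apply: icl_exp.
have Ja := (cube a Ba).1 ha; have Jb := (cube b Bb).1 hb.
have Jd : radical S (d - a).
  (* This uses [d^2 a = d] and [d^2 a^3 = a^2 d]. *)
  have -> : d - a = d * d * (a - a ^+ 3) - (a - a ^+ 2 * d).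
    have d3 : d * d * a * a * a = a * a * d.
      by rewrite -ddc da -mulrA da mulrA.
    transitivity (d * d * a - d * d * a * a * a - (a - a ^+ 2 * d)); last by ncring.
    by rewrite d3 -ddc; ncring.
  apply: radicalB => //; apply: radicalMl => //; exact: icl_mul.
rewrite cube; last exact: icl_add.
rewrite cube; last by apply: icl_add; [exact: icl1|exact: icl_mul].
exact: (@radical_cube _ _ S c).
Qed.
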